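(* Let $G$ be a topological group. (1) If $G$ has a dense subgroup that is TA (in the subspace topology), then $G$ is TA. (2) If $G$ has a dense subgroup that is TNA (in the subspace topology), then $G$ is TNA.
   Context: All topological groups are assumed to be Hausdorff. A topological group is topologically non-Archimedean (TNA) if every neighborhood of the neutral element contains an open subgroup. A topological group is topologically Archimedean (TA) if it has no proper open subgroups. *)

(* Defs.v *)
From HB Require Import structures.
From mathcomp Require Import all_boot.
From mathcomp Require Import all_classical.
From mathcomp Require Import topology.

Set Implicit Arguments.
Unset Strict Implicit.
Unset Printing Implicit Defensive.

Local Open Scope classical_set_scope.
Local Open Scope group_scope.

HB.mixin Record isTopologicalGroup G & Topological G & Group G := {
  mulg_continuous : continuous (fun x : G * G => x.1 * x.2) ;
  invg_continuous : continuous (fun x : G => x^-1)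
}.

(* The Hausdorff axiom is not part of the structure: it is stated separately
   with [hausdorff_space]. *)
#[short(type="topologicalGroupType")]
HB.structure Definition TopologicalGroup :=
  {G of Topological G & Group G & isTopologicalGroup G}.

(* [group_closed] is: contains 1 and is closed under x * y^-1. *)
Record subgroup (G : groupType) := Subgroup {
  subgroup_set :> set G ;
  subgroup_closed : group_closed [in subgroup_set]
}.

(* A subgroup [H], coerced to the type [set_type H], is a group; for [G] a
   topological group, [set_type H] already carries the subspace topology (the
   initial topology for the inclusion), which makes it a topological group. *)
HB.instance Definition _ (G : groupType) (H : subgroup G) :=
  SubChoice.copy (set_type H) {x : G | x \in (H : set G)}.
HB.instance Definition _ (G : groupType) (H : subgroup G) :=
  SubChoice_isSubGroup.Build G _ (set_type H) (subgroup_closed H).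

Section subgroup_topology.
Context (G : topologicalGroupType) (H : subgroup G).

Let val_continuous : continuous (\val : set_type H -> G).
Proof. exact: initial_continuous. Qed.

Let mulH_continuous :
  continuous (fun x : set_type H * set_type H => x.1 * x.2).
Proof.
apply: continuous_comp_initial => x.
rewrite (_ : _ \o _ = (fun y : G * G => y.1 * y.2) \o
    (fun y : set_type H * set_type H => (\val y.1, \val y.2)))//.
apply: continuous_comp; last exact: mulg_continuous.
apply: cvg_pair.
  by apply: continuous_comp; [exact: cvg_fst|exact: val_continuous].
by apply: continuous_comp; [exact: cvg_snd|exact: val_continuous].
Qed.

Let invH_continuous : continuous (fun x : set_type H => x^-1).
Proof.
apply: continuous_comp_initial => x.
rewrite (_ : _ \o _ = (fun y : G => y^-1) \o \val)//.
by apply: continuous_comp; [exact: val_continuous|exact: invg_continuous].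
Qed.

HB.instance Definition _ :=
  isTopologicalGroup.Build (set_type H) mulH_continuous invH_continuous.

End subgroup_topology.

(* Topologically non-Archimedean. *)
Definition TNA (G : topologicalGroupType) : Prop :=
  forall U : set G, nbhs (1 : G) U ->
    exists H : subgroup G, open H /\ H `<=` U.

(* Topologically Archimedean. *)
Definition TA (G : topologicalGroupType) : Prop :=
  forall H : subgroup G, open H -> H = setT :> set G.

(* Main.v *)
Require Import Defs.
From HB Require Import structures.
From mathcomp Require Import all_boot.
From mathcomp Require Import all_classical.
From mathcomp Require Import topology.

(** Both parts transport open subgroups between [G] and a dense subgroup [D].

    If [H] is an open subgroup of [G], its trace on [D] is an open subgroup of
    [D].  When [D] is TA the trace is all of [D], so [H] contains [D]; each
    left coset of [H] is open, hence meets [D] and therefore [H], so it is [H]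
    itself ([TA_of_dense]).

    Conversely, if [K] is an open subgroup of [D], its closure in [G] is a
    subgroup of [G] ([subgroup_closure]).  Write [K] as the trace on [D] of an
    open subset [W] of [G].  By density the closure of [K] contains [W], so
    the closure is a neighborhood of [1] and is open.  When [D] is TNA, [K]
    can be taken inside any prescribed neighborhood of [1]; its closure is
    still small because every neighborhood of [1] contains the closure of a
    neighborhood of [1] ([nbhs1_closure]) ([TNA_of_dense]). *)

Local Open Scope classical_set_scope.
Local Open Scope group_scope.

(** * Translations and small neighborhoods *)

Section Translations.
Context {G : topologicalGroupType}.
Implicit Types (x y : G) (A U : set G).

Lemma divg_continuous : continuous (fun z : G * G => z.1 / z.2).
Proof.
move=> z; apply: (@cvg_comp _ _ _ (fun z : G * G => (z.1, z.2^-1))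
  (fun z : G * G => z.1 * z.2) _ _ _ _ (mulg_continuous (z.1, z.2^-1))).
apply: cvg_pair; first exact: cvg_fst.
by apply: continuous_comp; [exact: cvg_snd|exact: invg_continuous].
Qed.

Lemma mulgl_continuous x : continuous (fun y : G => x * y).
Proof.
move=> y; apply: (@cvg_comp _ _ _ (fun y : G => (x, y))
  (fun z : G * G => z.1 * z.2) _ _ _ _ (mulg_continuous (x, y))).
by apply: cvg_pair; [exact: cvg_cst|exact: cvg_id].
Qed.

Lemma nbhs_mulgl x A : nbhs 1 A -> nbhs x [set y | A (x^-1 * y)].
Proof. by move=> A1; apply: (mulgl_continuous x^-1 x); rewrite /= mulVg. Qed.

(** If [v / w] lies in [U] for all [v], [w] in [A], then a point [x] of the
    closure of [A] is in [U], because the neighborhood [x A] of [x] meets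
    [A]. *)
Lemma nbhs1_closure U : nbhs 1 U -> exists2 A, nbhs 1 A & closure A `<=` U.
Proof.
move=> U1.
have : nbhs ((1, 1) : G * G) [set z | U (z.1 / z.2)].
  by apply: (divg_continuous (1, 1)); rewrite /= mulgV.
move=> [[A B] [/= A1 B1] ABU].
exists (A `&` B); first exact: filterI.
move=> x /(_ _ (nbhs_mulgl x _ B1))[v [[Av _] /= Bv]].
by have := ABU (v, x^-1 * v) (conj Av Bv); rewrite /= invgM invgK mulVKg.
Qed.

End Translations.

(** * Subgroups *)

Lemma group_closedP {G : groupType} (A : set G) :
  group_closed [in A] <-> A 1 /\ forall x y, A x -> A y -> A (x / y).
Proof.
split=> [[A1 AV]|[A1 AV]]; split; first exact: set_mem.
- by move=> x y Ax Ay; apply: set_mem; apply: AV; apply: mem_set.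
- exact: mem_set.
- by move=> x y Ax Ay; apply: mem_set; apply: AV; apply: set_mem.
Qed.

Lemma subgroup1 {G : groupType} (H : subgroup G) : subgroup_set H 1.
Proof. exact: ((group_closedP _).1 (subgroup_closed H)).1. Qed.

Lemma subgroup_div {G : groupType} (H : subgroup G) x y :
  subgroup_set H x -> subgroup_set H y -> subgroup_set H (x / y).
Proof. exact: (((group_closedP _).1 (subgroup_closed H)).2 x y). Qed.

Lemma subgroup_mul {G : groupType} (H : subgroup G) x y :
  subgroup_set H x -> subgroup_set H y -> subgroup_set H (x * y).
Proof.
move=> Hx Hy; rewrite -[y]invgK; apply: subgroup_div => //.
by rewrite -[_^-1]mul1g; apply: subgroup_div => //; exact: subgroup1.
Qed.

Lemma subgroup_trace_closed {G : groupType} (H D : subgroup G) :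
  group_closed [in [set x : set_type D | subgroup_set H (\val x)]].
Proof.
apply/group_closedP; split; first exact: subgroup1.
by move=> x y; exact: subgroup_div.
Qed.

Definition subgroup_trace {G : groupType} (H D : subgroup G) :
    subgroup (set_type D) :=
  Subgroup (subgroup_trace_closed H D).

Lemma subgroup_image_closed {G : groupType} (D : subgroup G)
    (K : subgroup (set_type D)) :
  group_closed [in [set \val x | x in (K : set (set_type D))]].
Proof.
apply/group_closedP; split; first by exists 1; first exact: subgroup1.
by move=> _ _ [x Kx <-] [y Ky <-]; exists (x / y); first exact: subgroup_div.
Qed.

Definition subgroup_image {G : groupType} (D : subgroup G)
    (K : subgroup (set_type D)) : subgroup G :=
  Subgroup (subgroup_image_closed D K).

Section TopologicalSubgroups.
Context {G : topologicalGroupType}.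
Implicit Types H : subgroup G.

(** A subgroup contains the translate by [x] of any neighborhood of [1] that it
    contains, for each of its points [x]. *)
Lemma open_subgroup H : nbhs 1 (H : set G) -> open H.
Proof.
move=> H1; rewrite openE => x Hx.
apply: filterS (nbhs_mulgl x _ H1) => y /= Hxy.
by rewrite -[y](mulVKg x); apply: subgroup_mul.
Qed.

(** By continuity of division, points of the subgroup close to [x] and [y] have
    a quotient close to [x / y], and this quotient is in the subgroup. *)
Lemma subgroup_closure_closed H : group_closed [in closure (H : set G)].
Proof.
apply/group_closedP; split; first exact/subset_closure/subgroup1.
move=> x y clx cly N /(divg_continuous (x, y))[[A B] [/= Ax By] ABN].
have [a [Ha Aa]] := clx _ Ax; have [b [Hb Bb]] := cly _ By.
by exists (a / b); split; [exact: subgroup_div|exact: (ABN (a, b))].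
Qed.

Definition subgroup_closure H : subgroup G :=
  Subgroup (subgroup_closure_closed H).

End TopologicalSubgroups.

(** * Transfer from a dense subgroup *)

Lemma TA_of_dense (G : topologicalGroupType) (D : subgroup G) :
  dense D -> TA (set_type D) -> TA G.
Proof.
move=> dD taD H oH.
have HD : subgroup_trace H D = setT :> set _.
  by apply: taD; apply: open_comp => // x _; exact: initial_continuous.
have DH d : subgroup_set D d -> subgroup_set H d.
  move=> Dd; have : subgroup_set (subgroup_trace H D) (SigSub (mem_set Dd)).
    by rewrite HD.
  by [].
apply/seteqP; split=> // x _.
(* The coset [x H] is written as the set of [y] with [x^-1 * y] in [H]. *)
have [||y [Hxy /DH Hy]] := dD [set y | subgroup_set H (x^-1 * y)].
- by exists x; rewrite /= mulVg; exact: subgroup1.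
- by apply: open_comp => // y _; exact: mulgl_continuous.
- have -> : x = y * (x^-1 * y)^-1 by rewrite invgM invgK mulVKg.
  exact: subgroup_div.
Qed.

Lemma TNA_of_dense (G : topologicalGroupType) (D : subgroup G) :
  dense D -> TNA (set_type D) -> TNA G.
Proof.
move=> dD tnaD U /nbhs1_closure[A A1 AU].
have [|K [[W oW WK] KA]] := tnaD (\val @^-1` A).
  have cval : continuous (\val : set_type D -> G) by exact: initial_continuous.
  exact: (cval 1 A A1).
exists (subgroup_closure (subgroup_image D K)); split; last first.
  apply: subset_trans AU; apply: closure_subset => _ [x Kx <-]; exact: KA.
apply: open_subgroup.
have W1 : W 1.
  by have := subgroup1 K; rewrite -WK.
(* Near a point of [W], density provides points of [D] in [W], that is,
   points of [K]. *)
apply: (filterS _ (open_nbhs_nbhs (conj oW W1))) => w Ww N.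
rewrite nbhsE => -[O [oO Ow] ON].
have [||y [[Oy Wy] Dy]] := dD (O `&` W).
- by exists w.
- exact: openI.
- exists y; split; last exact: ON.
  by exists (SigSub (mem_set Dy)); first by rewrite -WK.
Qed.

Theorem proposition2p4 (G : topologicalGroupType) (hG : hausdorff_space G) :
  ((exists D : subgroup G, dense D /\ TA (set_type D)) -> TA G) /\
  ((exists D : subgroup G, dense D /\ TNA (set_type D)) -> TNA G).
Proof.
by split=> -[D [dD]]; [exact: TA_of_dense|exact: TNA_of_dense].
Qed.
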